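(* Let $H$ be a finite graph. The class of all $H$-subgraph-free graphs has bounded cop number if and only if every connected component of $H$ is a tree with at most three leaves.
   Context: All graphs are finite, undirected, without loops or multiple edges. A graph is $H$-subgraph-free if it contains no (not necessarily induced) subgraph isomorphic to $H$. Cops and Robber game on a connected graph: for an integer $k\ge 1$, the cop player places $k$ cops on (not necessarily distinct) vertices, then the robber is placed on a vertex; then, starting with the cops, the players alternate moves. In a cop move, each cop either stays or moves to an adjacent vertex; in a robber move, the robber stays or moves to an adjacent vertex. The cops win if at some point a cop and the robber occupy the same vertex. Both players have complete information. The cop number $\mathrm{cop}(G)$ of a connected graph $G$ is the smallest $k$ such that the cops have a winning strategy with $k$ cops; for a non-connected graph it is the maximum cop number of its connected components. A class of graphs has bounded cop number if there is a constant $C$ with $\mathrm{cop}(G)\le C$ for all $G$ in the class. A single vertex is a tree (with at most three leaves). *)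

(* Defs.v *)
From mathcomp Require Import all_boot all_order.
Set Implicit Arguments. Unset Strict Implicit. Unset Printing Implicit Defensive.

Definition simple_graph (T : finType) (e : rel T) : Prop :=
  symmetric e /\ irreflexive e.

Definition has_subgraph (TH : finType) (eH : rel TH) (T : finType) (e : rel T) : Prop :=
  exists f : TH -> T, injective f /\ (forall x y, eH x y -> e (f x) (f y)).

Definition subgraph_free (TH : finType) (eH : rel TH) (T : finType) (e : rel T) : Prop :=
  ~ has_subgraph eH e.

Definition comp_type (T : finType) (e : rel T) (v : T) : finType :=
  {x : T | connect e v x}.

Definition comp_rel (T : finType) (e : rel T) (v : T) : rel (comp_type e v) :=
  fun x y => e (val x) (val y).
Arguments comp_rel {T} e v.

Definition cop_move (T : finType) (e : rel T) (k : nat) (c c' : {ffun 'I_k -> T}) : Prop :=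
  forall i, c' i = c i \/ e (c i) (c' i).

Definition rob_move (T : finType) (e : rel T) (r r' : T) : Prop := r' = r \/ e r r'.

(* cwin e c r : cops at c, robber at r, cops to move: the cops can force a
   capture (least fixed point = winning region of the reachability game). *)
Inductive cwin (T : finType) (e : rel T) (k : nat) : {ffun 'I_k -> T} -> T -> Prop :=
| CWin (c : {ffun 'I_k -> T}) (r : T) (c' : {ffun 'I_k -> T}) :
    cop_move e c c' ->
    ((exists i, c' i = r) \/
     (forall r', rob_move e r r' -> (exists i, c' i = r') \/ cwin e c' r')) ->
    cwin e c r.

Definition cops_win (T : finType) (e : rel T) (k : nat) : Prop :=
  exists c0 : {ffun 'I_k -> T}, forall r0 : T, (exists i, c0 i = r0) \/ cwin e c0 r0.

Definition cop_number_le (T : finType) (e : rel T) (C : nat) : Prop :=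
  forall v : T, exists k : nat, 1 <= k <= C /\ cops_win (comp_rel e v) k.

Definition bounded_cop_number_Hfree (TH : finType) (eH : rel TH) : Prop :=
  exists C : nat, forall (T : finType) (e : rel T),
    simple_graph e -> subgraph_free eH e -> cop_number_le e C.

Definition acyclic (T : finType) (e : rel T) : Prop :=
  forall c : seq T, uniq c -> 3 <= size c -> ~~ cycle e c.

Definition is_tree (T : finType) (e : rel T) : Prop :=
  (forall x y, connect e x y) /\ acyclic e.

Definition leaves (T : finType) (e : rel T) : {set T} :=
  [set x | #|[set y | e x y]| == 1].

(* Main.v *)
(* If every component of [H] is a tree with at most three leaves, then [H]
   embeds in a disjoint union of [|H|] spiders with three legs of length
   [m = |H|].  Cops can station themselves on a spider found in the robber's
   territory, so one may assume there is none.  The cops then chase the robber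
   along a path [x_0 ... x_j] as in a depth-first search, always stepping into
   the robber's component [C].  If [C] had a neighbour [x_i] with
   [m <= i <= j - 2m], there would be a spider centred at [x_i]: its legs go
   back towards [x_0], forward along the path, and through [C] to [x_j] and
   back down.  So it suffices to hold the first [m] and the last [2m]
   vertices of the path.

   Conversely, there are subcubic graphs of large girth whose vertices of degree
   three are far apart and which have large cop number: a Cayley-type cover of a
   subdivided theta graph by the permutation group generated by one involution
   per edge, acting on truncated reduced words.  Such a graph contains no cycle
   of bounded length and no bounded tree with four leaves.  The robber picks, among
   more than [k] non-backtracking walks of length [D], one beyond which no cop
   stands within distance [3D], and runs along it. *)

From Stdlib Require Import Classical.
Require Import Defs.
From mathcomp Require Import fingroup perm zify all_boot.
Set Implicit Arguments. Unset Strict Implicit. Unset Printing Implicit Defensive.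

(** * Non-backtracking walks *)

Lemma nuniq_split (T : eqType) (p : seq T) : ~~ uniq p ->
  exists y p1 p2 p3, p = p1 ++ y :: rcons p2 y ++ p3.
Proof.
elim: p => //= a p IH; rewrite negb_and negbK => /orP[|/IH].
  by case/splitPr=> p1 p2; exists a, [::], p1, p2; rewrite cat_rcons.
by case=> y [p1 [p2 [p3 ->]]]; exists y, (a :: p1), p2, p3.
Qed.

Section NonBacktracking.

Variables (T : finType) (e : rel T).

(* A walk continuing from [v] whose predecessor is [u]; taking [u = v] encodes
   the absence of a predecessor, since [e] will be irreflexive. *)
Fixpoint nbwalk (u v : T) (p : seq T) : bool :=
  if p is w :: p' then [&& e v w, w != u & nbwalk v w p'] else true.

(** In a simple graph this says that the girth exceeds [N], since a closed non-backtracking walk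
    contains a cycle no longer than itself. *)
Definition nb_girth_gt (N : nat) : Prop :=
  forall x p, 0 < size p <= N -> nbwalk x x p -> last x p <> x.

Definition deg (x : T) : nat := #|[set y | e x y]|.

Lemma nbwalk_path u v p : nbwalk u v p -> path e v p.
Proof. by elim: p u v => //= w p IH u v /and3P[-> _ /IH]. Qed.

(** [last u (belast v p)] is the last vertex but one of the walk, or [u] if [p] is empty. *)
Lemma nbwalk_cat u v p q :
  nbwalk u v (p ++ q) = nbwalk u v p && nbwalk (last u (belast v p)) (last v p) q.
Proof. by elim: p u v => [//|w p IH] u v /=; rewrite IH !andbA. Qed.

Lemma uniq_nbwalk u v p : path e v p -> uniq (v :: p) -> u \notin p -> nbwalk u v p.
Proof.
elim: p u v => //= w p IH u v /andP[evw pp] /andP[vN /andP[wN un]].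
rewrite inE negb_or => /andP[uw uN]; rewrite evw eq_sym uw /=.
apply: IH => //=; first by rewrite wN.
by move: vN; rewrite inE negb_or => /andP[].
Qed.

Lemma uniq_nbwalk_refl v p : path e v p -> uniq (v :: p) -> nbwalk v v p.
Proof. by move=> pp un; apply: uniq_nbwalk => //; case/andP: un. Qed.

Lemma nbwalk_extend u v p y : nbwalk u v p -> e (last v p) y ->
  [\/ nbwalk u v (rcons p y),
      exists2 q, p = rcons q (last v p) & last v q = y
    | p = [::] /\ y = u].
Proof.
case/lastP: p => [_ /= evy|p x].
  have [->|yu] := eqVneq y u; first by constructor 3.
  by constructor 1; rewrite evy.
rewrite last_rcons => wp exy.
have [<-|yl] := eqVneq (last v p) y; first by constructor 2; exists p.
constructor 1; rewrite -cats1 nbwalk_cat wp last_rcons /= exy andbT.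
by rewrite belast_rcons /= eq_sym yl.
Qed.

Lemma nbwalk_pred u v p : e u v -> nbwalk u v p -> e (last u (belast v p)) (last v p).
Proof.
move=> euv; case/lastP: p => [//|p x].
rewrite -cats1 nbwalk_cat last_cat => /andP[_ /= /andP[+ _]].
by rewrite cats1 belast_rcons.
Qed.

Hypotheses (esym : symmetric e) (eirr : irreflexive e).

Lemma nbwalk_forget u v p : nbwalk u v p -> nbwalk v v p.
Proof.
case: p => //= w p /and3P[evw _ ->]; rewrite evw andbT /=.
by apply: contraTneq evw => ->; rewrite eirr.
Qed.

(** Reverse [p], then follow [q]. The predecessor [head v p] keeps [q] from starting with the first
    edge of [p]. *)
Lemma nbwalk_join u v p q : nbwalk u v p -> nbwalk (head v p) v q ->
  let x := last v p in
  exists s, [/\ nbwalk x x s, last x s = last v q & size s = size p + size q].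
Proof.
elim: p u v q => [|a p IH] u v q /=; first by exists q.
case/and3P=> eva _ ap vq.
have [|s [s1 s2 s3]] := IH _ _ (v :: q) ap.
  rewrite /= esym eva vq andbT /=.
  case: p ap {IH} => [_|w p /= /and3P[_ + _]]; last by rewrite eq_sym.
  by apply: contraTneq eva => ->; rewrite eirr.
by exists s; split=> //; rewrite s3 /= addnS.
Qed.

(** Past their common prefix, two different walks with the same end would yield a short closed walk:
    one of them reversed, followed by the other. *)
Lemma nbwalk_inj N u v p q : nb_girth_gt N ->
  nbwalk u v p -> nbwalk u v q -> last v p = last v q -> size p + size q <= N -> p = q.
Proof.
move=> girth; elim: p q u v => [|a p IH] [|b q] u v //.
- move=> _ wq lq sz; case: (girth v (b :: q)) => //; exact: nbwalk_forget wq.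
- move=> wp _ lp sz; case: (girth v (a :: p)) => //; last exact: nbwalk_forget wp.
  by rewrite addn0 in sz.
- move=> wp wq; have := wp; have := wq; rewrite /=.
  move=> /and3P[evb ub bq] /and3P[eva ua ap] lpq sz.
  have [ab|ab] := eqVneq a b.
    subst b; congr (_ :: _); apply: (IH _ v a) => //.
    by apply: leq_trans sz; rewrite addSn addnS !leqW.
  have [||s [s1 s2 s3]] := @nbwalk_join u v (a :: p) (b :: q) => //.
    by rewrite /= evb bq eq_sym ab.
  by case: (girth (last a p) s) => //; rewrite ?s3 // s2.
Qed.

(** A closed walk without repetition is a cycle; otherwise the part between two visits of a vertex
    is a shorter closed walk. *)
Lemma acyclic_nb_girth N : acyclic e -> nb_girth_gt N.
Proof.
move=> ac x p; have [n] := ubnP (size p); elim: n x p => // n IH x p sp /andP[p0 pN] wp lp.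
have [up|] := boolP (uniq p).
  have p3 : 2 < size p.
    case: p {sp pN IH up} p0 wp lp => [|a [|b [|c p]]] //= _.
      by move=> /andP[exa _] ax; move: exa; rewrite ax eirr.
    by move=> /and5P[_ _ _ + _] bx; rewrite bx eqxx.
  have /negP[] := ac p up p3.
  move/nbwalk_path: wp => wp.
  case: p {sp p3 pN up} p0 wp lp => //= a p _ /andP[exa pp] lp.
  by rewrite rcons_path pp lp.
case/nuniq_split=> y [p1 [p2 [p3 def_p]]].
have sp2 : size (rcons p2 y) < size p.
  by rewrite def_p size_cat /= size_cat addnS ltnS addnCA leq_addr.
move: wp; rewrite def_p -cat_rcons nbwalk_cat last_rcons => /andP[_].
rewrite nbwalk_cat => /andP[/nbwalk_forget wq _].
apply: (IH y (rcons p2 y)) => //; rewrite ?last_rcons //.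
  exact: leq_trans sp2 _.
by rewrite size_rcons /= -(size_rcons p2 y) (leq_trans _ pN) // ltnW.
Qed.

End NonBacktracking.

Lemma nbwalk_map (T U : finType) (e : rel T) (f : rel U) (h : T -> U) u v p :
    injective h -> (forall x y, e x y -> f (h x) (h y)) ->
  nbwalk e u v p -> nbwalk f (h u) (h v) (map h p).
Proof.
move=> hinj hom; elim: p u v => //= w p IH u v /and3P[/hom-> wu /IH->].
by rewrite (inj_eq hinj) wu.
Qed.

(** * Evading the cops in a graph of large girth *)

(* The generated scheme has no induction hypothesis under the disjunction. *)
Lemma cwin_nested_ind (T : finType) (e : rel T) k (P : {ffun 'I_k -> T} -> T -> Prop) :
  (forall c r c', cop_move e c c' ->
    (exists i, c' i = r) \/
    (forall r', rob_move e r r' -> (exists i, c' i = r') \/ P c' r') -> P c r) ->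
  forall c r, cwin e c r -> P c r.
Proof.
move=> step; exact: (fix IH c r (w : cwin e c r) : P c r :=
  match w with
  | CWin c r c' mv H => step c r c' mv
      (match H with
       | or_introl ci => or_introl ci
       | or_intror f => or_intror (fun r' m =>
           match f r' m with
           | or_introl ci => or_introl ci
           | or_intror w' => or_intror (IH c' r' w')
           end)
       end)
  end).
Qed.

Section RobberEscapes.

Variables (T : finType) (e : rel T) (k D : nat).
Hypotheses (esym : symmetric e) (eirr : irreflexive e).
Hypothesis girth : nb_girth_gt e (8 * D).
Hypothesis D_gt0 : 0 < D.
Hypothesis branching : forall u v, e u v -> exists ws : seq (seq T),
  [/\ uniq ws, k < size ws & forall p, p \in ws -> nbwalk e u v p /\ size p = D].

Let behind u v p n c := exists q,
  [/\ nbwalk e u v (p ++ q), size q <= n & last v (p ++ q) = c].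

(* The positions from which a cop could interfere with a robber that stands at
   [v], came from [u] and is committed to walking along [p]. *)
Definition danger u v p c :=
  behind u v [::] (2 * size p) c \/ behind u v p (2 * D + size p) c.

(** From [w :: p] to [p] the first bound drops by two, for the robber's step and the cop's, and the
    second by one, for the cop's step alone. *)
Lemma danger_step u v w p c c' : e u v -> nbwalk e u v (w :: p) -> size p < D ->
  c' = c \/ e c c' -> danger v w p c' -> danger u v (w :: p) c.
Proof.
move=> euv wwp pD cc'; have /and3P[evw wu wp] := wwp.
have ext q : nbwalk e v w q -> nbwalk e u v (w :: q) by rewrite /= evw wu.
case=> -[q [/ext wq sq lq]]; case: cc' => [cc'|ecc']; rewrite -?cc'.
- left; exists (w :: q); split=> //=.
  by rewrite mulnS !addSn add0n ltnS leqW.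
- have ec'c: e (last v (w :: q)) c by rewrite /= lq esym.
  left; case: (nbwalk_extend wq ec'c) => [wqc|[q' qq' lq']|[]//].
    exists (rcons (w :: q) c); split=> //; last by rewrite last_rcons.
    by rewrite size_rcons /= mulnS !addSn add0n !ltnS.
  exists q'; split=> //.
    by move: wq; rewrite qq' -cats1 nbwalk_cat => /andP[].
  have: size (w :: q) = (size q').+1 by rewrite qq' size_rcons.
  by case=> <-; rewrite mulnS (leq_trans sq) // leq_addl.
- by right; exists q; split=> //; rewrite /= addnS leqW.
- have ec'c: e (last v (w :: p ++ q)) c by rewrite /= lq esym.
  case: (nbwalk_extend wq ec'c) => [wqc|[q' qq' lq']|[]//].
    right; exists (rcons q c); split; first by rewrite /= rcons_cat in wqc *.
      by rewrite size_rcons /= addnS ltnS.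
    by rewrite -rcons_cat last_rcons.
  (* With [q] empty, a cop stepping back lands on the robber's own route and falls under the first
     kind of danger. *)
  case/lastP: q wq sq lq ec'c qq' => [|q x] wq sq lq ec'c qq'.
    rewrite cats0 in qq'; left; exists q'; split=> //.
      by move: wwp; rewrite qq' -cats1 nbwalk_cat => /andP[].
    have: size (w :: p) = (size q').+1 by rewrite qq' size_rcons.
    by case=> <-; rewrite /= mul2n -addnn leqW // leq_addr.
  right; exists q; move: qq'; rewrite -rcons_cat -rcons_cons => /rcons_inj[def_q' _].
  split; last by rewrite -lq' -def_q'.
    by move: wq; rewrite -rcons_cat -rcons_cons -cats1 nbwalk_cat => /andP[].
  by move: sq; rewrite size_rcons /= addnS => /ltnW/leqW.
Qed.

(* By the girth assumption, a cop is behind at most one of the [branching] walks. *)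
Lemma safe_walk (c : 'I_k -> T) u v : e u v ->
  exists p, [/\ nbwalk e u v p, size p = D & forall i, ~ behind u v p (3 * D) (c i)].
Proof.
move=> euv; have [ws [uws kws ws_ok]] := branching euv.
pose bad p i := [exists n : 'I_(3 * D).+1, [exists q : n.-tuple T,
  nbwalk e u v (p ++ q) && (last v (p ++ q) == c i)]].
have badP p i : reflect (behind u v p (3 * D) (c i)) (bad p i).
  apply: (iffP existsP) => [[n /existsP[q /andP[wq /eqP lq]]]|[q [wq sq lq]]].
    by exists q; rewrite size_tuple -ltnS.
  have sq' : size q < (3 * D).+1 by [].
  exists (Ordinal sq'); apply/existsP; exists (in_tuple q).
  by rewrite wq lq eqxx.
have [/hasP[p pws /existsPn np]|/hasPn all_bad] := boolP (has (fun p => ~~ [exists i, bad p i]) ws).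
  by have [wp sp] := ws_ok p pws; exists p; split=> // i /badP; apply/negP.
have : size [seq [pick i | bad p i] | p <- ws] <= size [seq Some i | i <- enum 'I_k].
  apply: uniq_leq_size.
    rewrite map_inj_in_uniq // => p p' pws p'ws /=.
    case: pickP => [i bi|nb]; last first.
      by have /existsP[i] := negPn (all_bad p pws); rewrite nb.
    case: pickP => [j bj [ij]|//]; rewrite -{j}ij in bj.
    have [[q [wq sq lq]] [q' [wq' sq' lq']]] := (badP _ _ bi, badP _ _ bj).
    have [[_ sp] [_ sp']] := (ws_ok p pws, ws_ok p' p'ws).
    have: p ++ q = p' ++ q'.
      apply: (nbwalk_inj esym eirr girth wq wq'); first by rewrite lq.
      (* Each of the two walks has length at most [D + 3 * D], whence the [8 * D] in the girth
         assumption. *)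
      rewrite !size_cat sp sp' -[8]/(1 + 3 + (1 + 3)) !mulnDl !mul1n.
      by rewrite leq_add // leq_add2l.
    by move/(congr1 (take D)); rewrite -{1}sp -sp' !take_size_cat // sp sp'.
  move=> o /mapP[p pws ->]; case: pickP => [i _|nb].
    by rewrite map_f ?mem_enum.
  by have /existsP[i] := negPn (all_bad p pws); rewrite nb.
by rewrite 2!size_map size_enum_ord leqNgt kws.
Qed.

(** Once the old walk is used up, its second bound [2 * D] is the first bound for a fresh walk of
    length [D]; the fresh second bound [2 * D + D] is what [safe_walk] provides. *)
Lemma safe_turn (c : {ffun 'I_k -> T}) u v : e u v ->
    (forall i, ~ danger u v [::] (c i)) ->
  exists w p, [/\ nbwalk e u v (w :: p), size p < D & forall i, ~ danger u v (w :: p) (c i)].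
Proof.
move=> euv safe; have [[|w p] [wp sp safe_p]] := safe_walk c euv.
  by move: D_gt0; rewrite -sp.
exists w, p; split=> //; first by rewrite -sp.
move=> i [bi|bi].
  by apply: (safe i); right; rewrite sp in bi; rewrite addn0.
by apply: (safe_p i); rewrite sp addnC -mulSn in bi.
Qed.

Lemma danger_next u v w p : nbwalk e u v (w :: p) -> danger u v (w :: p) w.
Proof.
move=> /and3P[evw wu _]; left; exists [:: w].
by split; rewrite //= ?evw ?wu // mulnS.
Qed.

(** At the cops' turn the invariant still refers to the moment before the robber's step from [v] to
    [r]. [danger_step] carries it past the cops' reply, and a fresh walk is chosen when [p] is used
    up. *)
Lemma robber_evades (c : {ffun 'I_k -> T}) r : cwin e c r ->
  forall u v p, e u v -> nbwalk e u v (r :: p) -> size p < D ->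
  (forall i, ~ danger u v (r :: p) (c i)) -> False.
Proof.
move: c r; apply: cwin_nested_ind => c r c' mv H u v p euv wp sp safe.
have safe' i : ~ danger v r p (c' i).
  by move=> di; apply: (safe i); apply: danger_step di => //; exact: mv.
have [evr _ wp'] := and3P wp.
case: H => [[i ci]|H].
  by apply: (safe' i); left; exists [::]; rewrite ci.
have [w [q [wq sq safeq]]] : exists w q,
    [/\ nbwalk e v r (w :: q), size q < D & forall i, ~ danger v r (w :: q) (c' i)].
  case: p {safe wp} sp safe' wp' => [|w q] sp safe' wp'; first exact: safe_turn.
  by exists w, q; split=> //; exact: ltnW.
have [|[i ci]|cw] := H w; first by right; case/and3P: wq.
  by apply: (safeq i); rewrite ci; exact: danger_next.
exact: (cw v r q).
Qed.

Lemma robber_wins x y : e x y -> ~ cops_win e k.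
Proof.
move=> exy [c H].
(* The robber starts as if it had just run along a safe walk: a cop at most [2 * D] steps beyond the
   end of [p] would be behind [p]. *)
have [p [wp sp safe]] := safe_walk c exy.
have euv := nbwalk_pred exy wp; set u := last _ _ in euv; set v := last _ _ in euv.
have [||w [q [wq sq safeq]]] := @safe_turn c u v => //.
  suff nd i : ~ behind u v [::] (2 * D + 0) (c i).
    by move=> i [[q [wq sq lq]]|//]; apply: (nd i); exists q; rewrite (leq_trans sq).
  case=> q [wq sq lq]; apply: (safe i); exists q.
  rewrite nbwalk_cat wp last_cat; split=> //; apply: leq_trans sq _.
  by rewrite addn0 leq_mul2r orbT.
case: (H w) => [[i ci]|cw].
  by apply: (safeq i); rewrite ci; exact: danger_next.
exact: (robber_evades cw euv wq sq safeq).
Qed.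

End RobberEscapes.

(** * Covers of large girth *)

(** A choice between two walks recurs after every block of [l] steps. *)
Lemma nbwalk_doubling (T : finType) (e : rel T) (l n : nat) :
  (forall u v, e u v -> exists p q, [/\ nbwalk e u v p, nbwalk e u v q,
     size p = l, size q = l & p != q]) ->
  forall u v, e u v -> exists ws : seq (seq T), [/\ uniq ws, size ws = 2 ^ n
    & forall p, p \in ws -> nbwalk e u v p /\ size p = n * l].
Proof.
move=> split2; elim: n => [|n IH] u v euv.
  by exists [:: [::]]; split=> // p; rewrite inE => /eqP->.
have [p [q [wp wq sp sq pq]]] := split2 u v euv.
have [wsp [up szp okp]] := IH _ _ (nbwalk_pred euv wp).
have [wsq [uq szq okq]] := IH _ _ (nbwalk_pred euv wq).
exists ([seq p ++ r | r <- wsp] ++ [seq q ++ r | r <- wsq]); split.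
- rewrite cat_uniq !map_inj_uniq ?up ?uq ?andbT /=; last 2 first.
  + by move=> r r' /eqP; rewrite eqseq_cat ?eqxx // => /eqP.
  + by move=> r r' /eqP; rewrite eqseq_cat ?eqxx // => /eqP.
  apply/hasPn=> _ /mapP[r rq ->]; apply/negP=> /mapP[r' _ /eqP].
  by rewrite eqseq_cat ?sp ?sq // eq_sym (negPf pq).
- by rewrite size_cat !size_map szp szq addnn -mul2n expnS.
- move=> s; rewrite mem_cat => /orP[] /mapP[r rs ->].
    have [wr sr] := okp r rs.
    by rewrite nbwalk_cat wp wr size_cat sp sr mulSn.
  have [wr sr] := okq r rs.
  by rewrite nbwalk_cat wq wr size_cat sq sr mulSn.
Qed.

Section ReducedWords.

Variables (L : eqType) (N : nat).
Implicit Types (l : L) (s : seq L).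

(* On reduced words this multiplies by [l] in the free product of copies of
   Z/2, truncated at length [N]; the inner test makes it an involution on all
   words. *)
Definition toggle l s :=
  if ohead s == Some l then (if ohead (behead s) == Some l then s else behead s)
  else if size s < N then l :: s else s.

Lemma size_toggle l s : size s <= N -> size (toggle l s) <= N.
Proof.
rewrite /toggle; case: ifP => _ sN; case: ifP => //= _.
by rewrite size_behead (leq_trans (leq_pred _)).
Qed.

Lemma toggleK s l : size s <= N -> toggle l (toggle l s) = s.
Proof.
move=> sN; rewrite /toggle; case h1: (ohead s == Some l).
  case h2: (ohead (behead s) == Some l); first by rewrite h1 h2.
  rewrite h2; case: s h1 h2 sN => //= a s /eqP[->] _ ->; by [].
case h3: (size s < N); first by rewrite /= eqxx h1.
by rewrite h1 h3.
Qed.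

End ReducedWords.

Section Lift.

Variables (V : finType) (b : rel V) (N : nat).
Hypotheses (bsym : symmetric b) (birr : irreflexive b).

Definition word := N.-bseq {set V}.

Definition toggle_word (l : {set V}) (s : word) : word :=
  Bseq (size_toggle l (size_bseq s)).

Lemma toggle_wordK l : involutive (toggle_word l).
Proof. by move=> s; apply: val_inj; rewrite /= toggleK // size_bseq. Qed.

Definition toggle_perm l : {perm word} := perm (can_inj (toggle_wordK l)).

Lemma toggle_permK l : (toggle_perm l * toggle_perm l = 1)%g.
Proof. by apply/perm.permP=> s; rewrite permM !permE toggle_wordK. Qed.

(* Edges are labelled by their sets of endpoints, so that a non-backtracking walk
   in the cover spells a reduced word. *)
Definition lift_rel : rel (V * {perm word}) :=
  fun x y => b x.1 y.1 && (y.2 == x.2 * toggle_perm [set x.1; y.1])%g.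

Lemma lift_sym : symmetric lift_rel.
Proof.
move=> x y; rewrite /lift_rel bsym setUC; congr (_ && _).
by apply/eqP/eqP=> ->; rewrite -mulgA toggle_permK mulg1.
Qed.

Lemma lift_irr : irreflexive lift_rel.
Proof. by move=> x; rewrite /lift_rel birr. Qed.

(** Consecutive edges of the walk have different labels: equal ones would lead back to the same
    vertex of [V] and, the generators being involutions, to the same permutation. So each toggle
    adds a letter to the word. *)
Lemma lift_nbwalk_toggle x y p (s : word) : lift_rel x y -> nbwalk lift_rel x y p ->
  ohead s = Some [set x.1; y.1] -> size s + size p <= N ->
  exists g : {perm word}, (last y p).2 = (y.2 * g)%g /\ size (g s) = size s + size p.
Proof.
elim: p x y s => [|z p IH] x y s xy /=.
  by exists 1%g; rewrite mulg1 perm1 addn0.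
case/and3P=> yz zx wp hs sz.
set l := [set y.1; z.1].
have ll : [set x.1; y.1] != l.
  have [/andP[bxy /eqP gy] /andP[_ /eqP gz]] := (xy, yz).
  apply: contraNneq zx => /setP/(_ x.1); rewrite !inE eqxx => /esym/orP[/eqP yx|/eqP zx].
    by rewrite -yx birr in bxy.
  rewrite [z]surjective_pairing [x]surjective_pairing gz gy -zx.
  by rewrite [[set y.1; _]]setUC -mulgA toggle_permK mulg1.
have tl : toggle_word l s = l :: s :> seq _.
  rewrite /= /toggle hs.
  by rewrite (inj_eq Some_inj) (negPf ll) ifT // (leq_trans _ sz) // addnS ltnS leq_addr.
have [||g [g1 g2]] := IH _ _ (toggle_word l s) yz wp; rewrite ?tl //=.
  by rewrite addSnnS.
exists (toggle_perm l * g)%g; split.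
  by rewrite g1 mulgA; congr (_ * _)%g; case/andP: yz => _ /eqP.
by rewrite permM permE g2 tl /= addSnnS.
Qed.

(** Along a closed walk the generators multiply to the identity, yet their product sends the empty
    word to a word as long as the walk. *)
Lemma lift_girth : nb_girth_gt lift_rel N.
Proof.
move=> x [|y p] //= pN /and3P[xy _ wp] lp.
set l := [set x.1; y.1].
pose s0 : word := @Bseq _ _ [::] (leq0n N).
have tl : toggle_word l s0 = [:: l] :> seq _.
  by rewrite /= /toggle /= ifT // (leq_trans _ pN).
have [||g [g1 g2]] := lift_nbwalk_toggle (s := toggle_word l s0) xy wp; rewrite ?tl //.
have /eqP g0 : (toggle_perm l * g = 1)%g.
  by apply: (mulgI x.2); rewrite mulg1 mulgA -[in RHS]lp g1; case/andP: xy => _ /eqP->.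
have tp : toggle_perm l s0 = toggle_word l s0 by rewrite permE.
by move: g2; rewrite tl -tp -permM (eqP g0) perm1.
Qed.

Lemma lift_nbwalk u v p : lift_rel u v -> nbwalk b u.1 v.1 p ->
  exists2 q, nbwalk lift_rel u v q & map fst q = p.
Proof.
elim: p u v => [|w p IH] u v uv /=; first by exists [::].
case/and3P=> vw wu wp; pose w' := (w, v.2 * toggle_perm [set v.1; w])%g.
have vw' : lift_rel v w' by rewrite /lift_rel vw eqxx.
have [q wq mq] := IH v w' vw' wp.
exists (w' :: q); rewrite /= ?mq // vw' wq andbT /=.
by apply: contraNneq wu => <-.
Qed.

Lemma nbwalk_unlift u v p : lift_rel u v -> nbwalk lift_rel u v p ->
  nbwalk b u.1 v.1 (map fst p).
Proof.
elim: p u v => [|w p IH] u v uv //= /and3P[vw wu wp].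
rewrite (IH v w) // andbT; have /andP[-> /eqP gw] := vw.
apply: contraNneq wu => w1; rewrite [w]surjective_pairing [u]surjective_pairing w1 gw.
have /andP[_ /eqP->] := uv.
by rewrite w1 [[set v.1; u.1]]setUC -mulgA toggle_permK mulg1.
Qed.

Lemma lift_deg x : deg lift_rel x = deg b x.1.
Proof.
rewrite /deg -(card_imset (f := fun w => (w, x.2 * toggle_perm [set x.1; w])%g)).
  apply: eq_card => y; rewrite inE; apply/idP/imsetP => [|[w]].
    case: y => y1 y2 /andP[/= bxy /eqP->]; exists y1; rewrite ?inE //.
  by rewrite inE => bxw ->; rewrite /lift_rel /= bxw eqxx.
by move=> w w' [].
Qed.

End Lift.

(** * Theta graphs *)

Section Theta.

Variable L : nat.
Hypothesis L_gt0 : 0 < L.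

Let V : finType := ('I_3 * 'I_L.+2)%type.

(* Two branch vertices, at heights [0] and [L.+1], joined by three paths; the
   pairs [(i, 0)] and [(i, L.+1)] with [i != 0] are isolated vertices. *)
Definition node (i j : nat) : V := (inord (if 0 < j <= L then i else 0), inord j).

Definition theta : rel V := fun x y => [exists i : 'I_3, exists j : 'I_L.+1,
  ((x, y) == (node i j, node i j.+1)) || ((y, x) == (node i j, node i j.+1))].

Lemma thetaP x y : reflect
  (exists i j, [/\ i < 3, j <= L & (x = node i j /\ y = node i j.+1) \/
                                   (y = node i j /\ x = node i j.+1)])
  (theta x y).
Proof.
apply: (iffP existsP) => [[i /existsP[j ij]]|[i [j [i3 jL ij]]]].
  exists i, j; split=> //; first by rewrite -ltnS.
  by case/orP: ij => /eqP[-> ->]; [left|right].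
have jL' : j < L.+1 by [].
exists (Ordinal i3); apply/existsP; exists (Ordinal jL') => /=.
by case: ij => -[-> ->]; rewrite eqxx ?orbT.
Qed.

Lemma theta_step i j : i < 3 -> j <= L -> theta (node i j) (node i j.+1).
Proof. by move=> i3 jL; apply/thetaP; exists i, j; split=> //; left. Qed.

Lemma node_height i j : j <= L.+1 -> (node i j).2 = j :> nat.
Proof. by move=> jL; rewrite inordK. Qed.

Lemma node_leg i j : i < 3 -> 0 < j <= L -> (node i j).1 = i :> nat.
Proof. by move=> i3 jL; rewrite /= jL inordK. Qed.

Lemma node_end i i' j : ~~ (0 < j <= L) -> node i j = node i' j.
Proof. by rewrite /node => /negPf->. Qed.

Lemma theta_sym : symmetric theta.
Proof.
by move=> x y; apply/thetaP/thetaP=> -[i [j [i3 jL [] ij]]]; exists i, j; split; auto.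
Qed.

Lemma theta_irr : irreflexive theta.
Proof.
move=> x; apply/negbTE/thetaP=> -[i [j [i3 jL H]]].
have: (node i j).2 = (node i j.+1).2 :> nat by case: H => -[<- <-].
by rewrite !node_height; lia.
Qed.

Lemma theta_inner i j y : i < 3 -> 0 < j <= L -> theta (node i j) y ->
  y = node i j.-1 \/ y = node i j.+1.
Proof.
move=> i3 jL /thetaP[i' [j' [i'3 j'L H]]]; case: H => [[xE ->]|[-> xE]].
  have jE : j = j'.
    by have := congr1 (fun x : V => nat_of_ord x.2) xE; rewrite !node_height //; lia.
  subst j'; right; congr node.
  by have := congr1 (fun x : V => nat_of_ord x.1) xE; rewrite !node_leg.
have jE : j = j'.+1.
  by have := congr1 (fun x : V => nat_of_ord x.2) xE; rewrite !node_height //; lia.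
subst j; left; congr node.
by have := congr1 (fun x : V => nat_of_ord x.1) xE; rewrite !node_leg.
Qed.

Lemma theta_bottom (x y : V) : x.2 = 0 :> nat -> theta x y ->
  exists2 i, i < 3 & x = node i 0 /\ y = node i 1.
Proof.
move=> x0 /thetaP[i [j [i3 jL [[xE yE]|[yE xE]]]]].
  by move: x0; rewrite xE node_height ?leqW // => j0; exists i; rewrite // yE j0.
by move: x0; rewrite xE node_height.
Qed.

(** This symmetry exchanges the two branch vertices, so that it suffices to study walks that go
    upwards. *)
Definition flip (x : V) : V := (x.1, rev_ord x.2).

Lemma flipK : involutive flip.
Proof. by case=> i j; rewrite /flip /= rev_ordK. Qed.

Lemma flip_node i j : j <= L.+1 -> flip (node i j) = node i (L.+1 - j).
Proof.
move=> jL; congr pair; first by congr inord; do 2!case: ifP; lia.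
by apply: val_inj; rewrite /= !inordK; lia.
Qed.

Lemma theta_flip x y : theta x y -> theta (flip x) (flip y).
Proof.
case/thetaP=> i [j [i3 jL H]]; apply/thetaP; exists i, (L - j); split=> //; first by lia.
have [E1 E2] : L.+1 - j = (L - j).+1 /\ L.+1 - j.+1 = L - j by lia.
by case: H => -[-> ->]; rewrite !flip_node ?E1 ?E2; [right|lia|lia|left|lia|lia].
Qed.

Lemma deg_flip x : deg theta (flip x) = deg theta x.
Proof.
rewrite /deg -(card_imset [set y | theta x y] (inv_inj flipK)); apply: eq_card => y; rewrite inE.
apply/idP/imsetP => [xy|[z]]; last first.
  by rewrite inE => /theta_flip xz ->.
by exists (flip y); rewrite ?flipK // inE -[x]flipK theta_flip.
Qed.

Lemma deg_theta_bottom (x : V) : x.2 = 0 :> nat -> deg theta x <= 3.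
Proof.
move=> x0; rewrite -[3]card_ord -cardsT.
apply: leq_trans (leq_imset_card (fun i : 'I_3 => node i 1) _).
apply: subset_leq_card; apply/subsetP=> y; rewrite inE => /(theta_bottom x0)[i i3 [_ ->]].
by apply/imsetP; exists (Ordinal i3).
Qed.

Lemma deg_theta x : deg theta x <= 3 /\
  (2 < deg theta x -> x.2 = 0 :> nat \/ (flip x).2 = 0 :> nat).
Proof.
have [x0|x0] := eqVneq (nat_of_ord x.2) 0.
  by split; [exact: deg_theta_bottom|left].
have [fx0|fx0] := eqVneq (nat_of_ord (flip x).2) 0.
  by rewrite -deg_flip; split; [exact: deg_theta_bottom|right].
suff: deg theta x <= 2 by move=> d2; split; [exact: leqW|rewrite ltnNge d2].
have [y xy|nox] := pickP (theta x); last first.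
  by rewrite /deg (@eq_card0 _ (mem [set y | theta x y])) // => y; rewrite inE.
have [i [j [i3 jL xE]]] : exists i j, [/\ i < 3, j <= L.+1 & x = node i j].
  case/thetaP: xy => i [j [i3 jL [[xE _]|[_ xE]]]].
    by exists i, j; split=> //; exact: leqW.
  by exists i, j.+1.
subst x; rewrite flip_node // !node_height // ?leq_subr // in x0 fx0.
have jI : 0 < j <= L by lia.
apply: (@leq_trans #|[set node i j.-1; node i j.+1]|); last by rewrite cards2; case: eqP.
apply: subset_leq_card; apply/subsetP=> z; rewrite !inE.
by case/(theta_inner i3 jI) => ->; rewrite eqxx ?orbT.
Qed.

(** Inside a leg the only neighbour other than the predecessor is the next vertex up, so the walk
    has no choice. *)
Lemma theta_climb i j p : i < 3 -> j + size p <= L ->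
  nbwalk theta (node i j) (node i j.+1) p -> last (node i j.+1) p = node i (j + size p).+1.
Proof.
move=> i3; elim: p j => [|w p IH] j /= sz; first by rewrite addn0.
case/and3P=> jw wj wp; have jL : 0 < j.+1 <= L by lia.
case: (theta_inner i3 jL jw) => wE; first by rewrite wE eqxx in wj.
by subst w; rewrite (IH j.+1) ?addSnnS.
Qed.

(** A walk from the bottom climbs to a height equal to its length, hence ends strictly between the
    two branch vertices. *)
Lemma theta_far x p : 2 < deg theta x -> 0 < size p <= L -> nbwalk theta x x p ->
  deg theta (last x p) <= 2.
Proof.
wlog x0 : x p / x.2 = 0 :> nat => [wl|].
  move=> dx; have [_ /(_ dx)[x0|x0]] := deg_theta x; first exact: wl.
  move=> sp wp; have := wl (flip x) (map flip p) x0.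
  rewrite size_map deg_flip last_map deg_flip; apply=> //.
  exact: (nbwalk_map (inv_inj flipK) theta_flip).
case: p => [|y p] // dx sp /and3P[xy _ wp].
have [i i3 [xE yE]] := theta_bottom x0 xy; subst x y.
rewrite leqNgt; apply/negP=> /(proj2 (deg_theta _)).
have pL : size p < L by case/andP: sp.
rewrite -[last _ _]/(last (node i 1) p) theta_climb // ?add0n ?flip_node; try lia.
by rewrite !node_height; lia.
Qed.

(** Both walks climb to the top and then take one step down, each into a different one of the other
    two legs. *)
Lemma theta_climb_split i j : i < 3 -> j <= L -> exists p q,
  [/\ nbwalk theta (node i j) (node i j.+1) p, nbwalk theta (node i j) (node i j.+1) q,
      size p = (L - j).+1, size q = (L - j).+1 & p != q].
Proof.
move=> i3; have [n] := ubnP (L - j); elim: n j => // n IH j jn jL.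
have [jL'|jL'] := eqVneq j L; last first.
  have [||p [q [wp wq sp sq pq]]] := IH j.+1; [lia|lia|].
  have s : theta (node i j.+1) (node i j.+2) by apply: theta_step => //; lia.
  have ne : node i j.+2 != node i j.
    apply/eqP=> /(congr1 (fun x : V => nat_of_ord x.2)).
    by rewrite !node_height; lia.
  exists (node i j.+2 :: p), (node i j.+2 :: q); rewrite /= s ne wp wq sp sq.
  by split=> //; [lia|lia|rewrite eqseq_cons eqxx].
subst j; rewrite subnn.
have down i' : i' < 3 -> i' != i -> nbwalk theta (node i L) (node i L.+1) [:: node i' L].
  move=> i'3 ii' /=; rewrite (@node_end i i' L.+1) ?ltnn ?andbF // theta_sym theta_step //=.
  rewrite andbT; apply: contraNneq ii' => /(congr1 (fun x : V => nat_of_ord x.1)).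
  by rewrite !node_leg ?L_gt0 // => ->.
exists [:: node ((i + 1) %% 3) L], [:: node ((i + 2) %% 3) L]; split=> //.
- by apply: down; lia.
- by apply: down; lia.
- apply/eqP=> /(congr1 (head (node 0 0))) /(congr1 (fun x : V => nat_of_ord x.1)).
  rewrite ![head _ _]/(node _ _).
  by rewrite !node_leg ?L_gt0 ?ltn_mod //; lia.
Qed.

Lemma theta_up x y : theta x y -> exists i j, [/\ i < 3, j <= L &
  (x = node i j /\ y = node i j.+1) \/ (flip x = node i j /\ flip y = node i j.+1)].
Proof.
case/thetaP=> i [j [i3 jL [H|[-> ->]]]]; first by exists i, j; split=> //; left.
exists i, (L - j); split=> //; first exact: leq_subr.
have [E1 E2] : L.+1 - j = (L - j).+1 /\ L.+1 - j.+1 = L - j by lia.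
by right; rewrite !flip_node ?E1 ?E2; [|lia|lia].
Qed.

Lemma theta_extend x y n p : theta x y -> nbwalk theta x y p ->
  exists2 r, nbwalk theta x y (p ++ r) & size r = n.
Proof.
move=> xy wp; elim: n => [|n [r wr sr]]; first by exists [::]; rewrite ?cats0.
have [z yz zx] : exists2 z, theta (last y (p ++ r)) z & z != last x (belast y (p ++ r)).
  have := nbwalk_pred xy wr; move: (last x _) (last y _) => u v uv.
  have [i [j [i3 jL H]]] := theta_up uv.
  have [[|w ws] [_ [wp' _ //= _ _ _]]] := theta_climb_split i3 jL.
  have /and3P[vw wu _] := wp'.
  case: H => -[uE vE]; first by exists w; rewrite ?uE ?vE.
  exists (flip w); first by rewrite -[v]flipK theta_flip // vE.
  by rewrite -[u]flipK (inj_eq (inv_inj flipK)) uE.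
exists (rcons r z); last by rewrite size_rcons sr.
by rewrite -rcons_cat -cats1 nbwalk_cat wr /= yz zx.
Qed.

(** The walks that part at the top are prolonged by [j] steps, so that their length is the same for
    all edges, as [nbwalk_doubling] requires. *)
Lemma theta_split u v : theta u v -> exists p q,
  [/\ nbwalk theta u v p, nbwalk theta u v q, size p = L.+1, size q = L.+1 & p != q].
Proof.
wlog [i [j [i3 jL [uE vE]]]] : u v / exists i j,
    [/\ i < 3, j <= L & (u = node i j /\ v = node i j.+1)].
  move=> wl uv; have [i [j [i3 jL [H|H]]]] := theta_up uv; first by apply: wl => //; exists i, j.
  have [||p [q [wp wq sp sq pq]]] := wl (flip u) (flip v); first by exists i, j.
    exact: theta_flip.
  exists (map flip p), (map flip q); rewrite !size_map -[u]flipK -[v]flipK.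
  split=> //; try exact: (nbwalk_map (inv_inj flipK) theta_flip).
  by rewrite (inj_eq (inj_map (inv_inj flipK))).
subst u v => uv; have [p [q [wp wq sp sq pq]]] := theta_climb_split i3 jL.
have [r wr sr] := theta_extend j uv wp; have [r' wr' sr'] := theta_extend j uv wq.
exists (p ++ r), (q ++ r'); split=> //; rewrite ?size_cat ?sp ?sq ?sr ?sr'; try lia.
by rewrite eqseq_cat ?sp ?sq // negb_and pq.
Qed.

End Theta.

(** * Restriction to a connected component *)

Section Component.

Variables (T : finType) (e : rel T) (x0 : T).

Lemma comp_rel_sym : symmetric e -> symmetric (comp_rel e x0).
Proof. by move=> es x y; apply: es. Qed.

Lemma comp_rel_irr : irreflexive e -> irreflexive (comp_rel e x0).
Proof. by move=> ei x; apply: ei. Qed.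

Lemma comp_nbwalk_lift (u v : comp_type e x0) p : nbwalk e (val u) (val v) p ->
  exists2 q, nbwalk (comp_rel e x0) u v q & map val q = p.
Proof.
elim: p u v => [|w p IH] u v /=; first by exists [::].
case/and3P=> vw wu wp.
have cw : connect e x0 w := connect_trans (valP v) (connect1 vw).
have [q wq mq] := IH v (Sub w cw) wp.
exists (Sub w cw :: q); rewrite /= ?mq //.
by rewrite wq andbT [comp_rel _ _ _ _]vw /=.
Qed.

Lemma comp_nbwalk_val (u v : comp_type e x0) p : nbwalk (comp_rel e x0) u v p ->
  nbwalk e (val u) (val v) (map val p).
Proof. exact: nbwalk_map val_inj _. Qed.

Lemma comp_girth N : nb_girth_gt e N -> nb_girth_gt (comp_rel e x0) N.
Proof.
move=> girth x p sp wp lp; apply: (girth (val x) (map val p)).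
- by rewrite size_map.
- exact: comp_nbwalk_val.
- by rewrite last_map lp.
Qed.

End Component.

Lemma evasive_subcubic k M : exists (T : finType) (e : rel T),
  [/\ simple_graph e, nb_girth_gt e M, (forall x, deg e x <= 3),
     (forall x p, 2 < deg e x -> 0 < size p <= M -> nbwalk e x x p ->
        deg e (last x p) <= 2)
   & ~ cop_number_le e k].
Proof.
(* [L] puts the branch vertices more than [M] apart, [k.+1] blocks of [L.+1] steps make up [D] and
   offer [2 ^ k.+1] walks, and [N] covers both girth requirements. *)
pose L := M.+1; pose D := k.+1 * L.+1; pose N := 8 * D + M.
have L0 : 0 < L by [].
have bs := @theta_sym L; have bi := @theta_irr L L0.
pose e := @lift_rel _ (@theta L) N; have es : symmetric e by apply: lift_sym.
have ei : irreflexive e by apply: lift_irr.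
have girth : nb_girth_gt e N by apply: lift_girth.
have weaken n : n <= N -> nb_girth_gt e n.
  by move=> nN x p /andP[p0 pn]; apply: girth; rewrite p0 (leq_trans pn).
exists _, e; split=> //.
- by apply: weaken; apply: leq_addl.
- by move=> x; rewrite lift_deg; case: (deg_theta L0 x.1).
- move=> x p; rewrite !lift_deg => dx /andP[p0 pM] wp; rewrite -last_map.
  apply: (theta_far L0) => //; first by rewrite size_map p0 leqW.
  case: p p0 wp {pM} => //= y p _ /and3P[xy _ wp].
  have /andP[bxy _] := xy; rewrite bxy (nbwalk_unlift xy wp) andbT /=.
  by apply: contraTneq bxy => ->; rewrite bi.
pose a : 'I_3 * 'I_L.+2 := node L 0 0; pose b := node L 0 1.
pose x : 'I_3 * 'I_L.+2 * {perm word ('I_3 * 'I_L.+2)%type N} := (a, 1%g).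
pose y : 'I_3 * 'I_L.+2 * {perm word ('I_3 * 'I_L.+2)%type N} := (b, toggle_perm N [set a; b]).
have exy : e x y.
  by rewrite /e /lift_rel /= mul1g eqxx andbT; apply: theta_step.
move/(_ x) => [k' [/andP[_ k'k]]].
have cx : connect e x x by apply: connect0.
have cy : connect e x y by apply: connect1.
apply: (@robber_wins _ _ k' D _ _ _ _ _ (Sub x cx) (Sub y cy)) => //.
- exact: comp_rel_sym.
- exact: comp_rel_irr.
- by apply/comp_girth/weaken/leq_addr.
move=> u v uv; have [|ws [uws sws wsP]] := @nbwalk_doubling _ (comp_rel e x) L.+1 k.+1 _ u v uv.
  move=> {uv}u {}v uv; have /andP[buv _] : e (val u) (val v) := uv.
  have [p [q [wp wq sp sq pq]]] := theta_split L0 buv.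
  have [p1 wp1 mp1] := lift_nbwalk uv wp; have [q1 wq1 mq1] := lift_nbwalk uv wq.
  have [p2 wp2 mp2] := comp_nbwalk_lift wp1; have [q2 wq2 mq2] := comp_nbwalk_lift wq1.
  exists p2, q2; split=> //.
  - by rewrite -(size_map val) mp2 -(size_map fst) mp1.
  - by rewrite -(size_map val) mq2 -(size_map fst) mq1.
  - by apply: contraNneq pq => pq2; rewrite -mp1 -mq1 -mp2 -mq2 pq2.
exists ws; split=> //; rewrite sws; apply: leq_ltn_trans k'k _.
by apply: ltn_trans (ltn_expl k.+1 _); rewrite // ltnS.
Qed.

(** * Trees with at most three leaves *)

Section Trees.

Variables (T : finType) (e : rel T).
Hypotheses (esym : symmetric e) (eirr : irreflexive e).
Hypothesis econn : forall x y, connect e x y.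
Hypothesis egirth : forall N, nb_girth_gt e N.

(** A tree with a center is a spider whose legs hang from [r]; on a path every vertex is a
    center. *)
Definition center r := deg e r <= 3 /\ forall x, x != r -> deg e x <= 2.

Lemma deg_gt1 x y z : e x y -> e x z -> y != z -> 1 < deg e x.
Proof.
move=> xy xz yz; apply: (@leq_trans #|[set y; z]|); first by rewrite cards2 yz.
by apply: subset_leq_card; apply/subsetP=> w; rewrite !inE => /orP[] /eqP->.
Qed.

Lemma tree_nbwalk_uniq u v p : nbwalk e u v p -> uniq (v :: p).
Proof.
elim: p u v => [//|w p IH] u v wvp; have /and3P[vw wu wp] := wvp.
rewrite cons_uniq (IH _ _ wp) andbT; apply/negP=> /splitPr vp.
case: vp wvp => p1 p2; rewrite -cat_rcons nbwalk_cat => /andP[/(nbwalk_forget eirr) wc _].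
by apply: (@egirth (size (rcons p1 v)) v _ _ wc); rewrite ?last_rcons // size_rcons /=.
Qed.

Lemma tree_nbwalk_inj u v p q : nbwalk e u v p -> nbwalk e u v q ->
  last v p = last v q -> p = q.
Proof.
move=> wp wq pq; exact: (nbwalk_inj esym eirr (@egirth (size p + size q)) wp wq pq).
Qed.

Lemma tree_walk x y : exists2 p, nbwalk e x x p & last x p = y.
Proof.
have /connectP[p pp ->] := econn x y; case/shortenP: pp => q pq uq _.
by exists q => //; apply: uniq_nbwalk_refl.
Qed.

(** A walk can be prolonged until it reaches a leaf, and it never repeats a vertex, so it stops
    within [#|T|] steps. *)
Lemma walk_to_leaf u v : e u v -> exists2 p, nbwalk e u v p & deg e (last v p) = 1.
Proof.
move=> uv; suff leaf_or n : (exists2 p, nbwalk e u v p & deg e (last v p) = 1) \/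
    (exists2 p, nbwalk e u v p & size p = n).
  case: (leaf_or #|T|) => // -[p /tree_nbwalk_uniq/card_uniqP up sp].
  by have := max_card (mem (v :: p)); rewrite up /= sp ltnn.
elim: n => [|n [IH|[p wp sp]]]; [by right; exists [::]|by left|].
have [d1|d1] := eqVneq (deg e (last v p)) 1; first by left; exists p.
right; set x := last v p in d1; set w := last u (belast v p).
have wx : e w x := nbwalk_pred uv wp.
have [y xy yw] : exists2 y, e x y & y != w.
  apply/exists_inP; apply: contraNT d1; rewrite negb_exists_in => /forall_inP all_w.
  rewrite /deg (_ : [set y | e x y] = [set w]) ?cards1 //.
  apply/setP=> y; rewrite !inE; apply/idP/eqP=> [xy|->]; last by rewrite esym.
  by apply/eqP; have := all_w y xy; rewrite negbK.
exists (rcons p y); last by rewrite size_rcons sp.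
by rewrite -cats1 nbwalk_cat wp /= xy yw.
Qed.

(** By [tree_nbwalk_inj], different walks from [w] end at different leaves. *)
Lemma leaf_walks w (ws : seq (seq T)) : uniq ws ->
    (forall p, p \in ws -> nbwalk e w w p /\ deg e (last w p) = 1) ->
  size ws <= #|leaves e|.
Proof.
move=> uws okws; rewrite -(size_map (last w)) cardE; apply: uniq_leq_size.
  rewrite map_inj_in_uniq // => p q /okws[wp _] /okws[wq _]; exact: tree_nbwalk_inj wp wq.
by move=> x /mapP[p /okws[_ dp] ->]; rewrite mem_enum inE -/(deg e _) dp.
Qed.

Lemma deg_le_leaves x : deg e x <= #|leaves e|.
Proof.
have walk y : exists p, e x y -> nbwalk e x y p /\ deg e (last y p) = 1.
  case xy: (e x y); last by exists [::].
  by have [p] := walk_to_leaf xy; exists p.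
have [w wP] := fin_all_exists walk.
rewrite /deg cardE -(size_map (fun y => y :: w y)).
apply: (@leaf_walks x); first by rewrite map_inj_uniq ?enum_uniq // => y z [].
move=> p /mapP[y]; rewrite mem_enum inE => xy ->.
have [wy ly] := wP y xy; split=> //.
by rewrite /= xy wy andbT; apply: contraTneq xy => ->; rewrite eirr.
Qed.

(** All walks start at [x]: some leave it in a direction other than [y], the others run to [y] and
    leave it by an edge not yet used. *)
Lemma deg2_le_leaves x y : x != y -> (deg e x).-1 + (deg e y).-1 <= #|leaves e|.
Proof.
move=> xy; have [q wq lq] := tree_walk x y.
case: q wq lq => [_ /= yx|a q wq lq]; first by rewrite yx eqxx in xy.
have /and3P[xa ax wq'] := wq.
set z := last x (belast x (a :: q)).
have zy : e z y by rewrite -lq; apply: nbwalk_pred wq'.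
have walk u v : exists p, e u v -> nbwalk e u v p /\ deg e (last v p) = 1.
  case uv: (e u v); last by exists [::].
  by have [p] := walk_to_leaf uv; exists p.
have [wx wxP] := fin_all_exists (walk x); have [wy wyP] := fin_all_exists (walk y).
pose A := [set v | e x v] :\ a; pose B := [set v | e y v] :\ z.
have -> : (deg e x).-1 = size (enum A).
  by rewrite -cardE /deg (cardsD1 a) inE xa.
have -> : (deg e y).-1 = size (enum B).
  by rewrite -cardE /deg (cardsD1 z) inE esym zy.
rewrite -(size_map (fun v => v :: wx v)) -(size_map (fun v => a :: q ++ v :: wy v) (enum B)).
rewrite -size_cat; apply: (@leaf_walks x).
  rewrite cat_uniq !map_inj_uniq ?enum_uniq ?andbT /=; last 2 first.
  - by move=> v v' [] /(congr1 (drop (size q))); rewrite !drop_size_cat // => -[].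
  - by move=> v v' [].
  apply/hasPn=> _ /mapP[v _ ->]; apply/negP=> /mapP[v']; rewrite mem_enum !inE.
  by case/andP=> va _ [av]; rewrite av eqxx in va.
move=> p; rewrite mem_cat => /orP[] /mapP[v]; rewrite mem_enum !inE => /andP[vn ev] ->.
  have [w l] := wxP v ev; split=> //.
  by rewrite /= ev w andbT; apply: contraTneq ev => ->; rewrite eirr.
have [w l] := wyP v ev; rewrite -cat_cons last_cat lq; split=> //.
by rewrite nbwalk_cat wq lq /= ev w andbT.
Qed.

Lemma center_exists (x : T) : (forall y, deg e y <= 3) ->
  (forall y z, y != z -> 2 < deg e y -> deg e z <= 2) -> exists r, center r.
Proof.
move=> d3 d2; have [r dr|nor] := pickP (fun y => 2 < deg e y).
  by exists r; split=> // y; rewrite eq_sym => /d2; apply.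
by exists x; split=> // y _; rewrite leqNgt nor.
Qed.

Lemma center_of_leaves (x : T) : #|leaves e| <= 3 -> exists r, center r.
Proof.
move=> l3; apply: center_exists => // [y|y z yz dy].
  exact: leq_trans (deg_le_leaves y) l3.
(* Two vertices of degree at least three would force [2 + 2] leaves. *)
by have := deg2_le_leaves yz; lia.
Qed.

Section Center.

Variable r : T.
Hypothesis rP : center r.

(** A vertex other than [r] has at most one neighbour besides its predecessor, so both walks are
    forced while the shorter one avoids [r]. *)
Lemma same_leg_prefix u v p q : e u v -> r \notin v :: p -> nbwalk e u v p ->
  nbwalk e u v q -> size p <= size q -> exists s, q = p ++ s.
Proof.
elim: p q u v => [|a p IH] [|b q] u v uv //=; first by exists [::].
  by exists (b :: q).
rewrite in_cons negb_or => /andP[rv rp] /and3P[va au wp] /and3P[vb bu wq] sz.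
have ab : b = a.
  apply/eqP; have := proj2 rP v; rewrite eq_sym => /(_ rv); apply: contraTT => ba.
  rewrite -ltnNge; apply: (@leq_trans #|u |: [set b; a]|).
    by rewrite cardsU1 cards2 ba !inE ![u == _]eq_sym (negPf au) (negPf bu).
  apply: subset_leq_card; apply/subsetP=> x; rewrite !inE.
  by case/or3P=> /eqP-> //; rewrite esym.
by subst b; have [s ->] := IH q v a va rp wp wq sz; exists s.
Qed.

Lemma same_leg a p q : nbwalk e r r (a :: p) -> nbwalk e r r (a :: q) ->
  size p <= size q -> exists s, q = p ++ s.
Proof.
move=> wp; have := tree_nbwalk_uniq wp; case/andP=> rp _.
by case/and3P: wp => ra _ wp /and3P[_ _ wq]; apply: same_leg_prefix wq.
Qed.

Lemma inner_deg a p b s : nbwalk e r r (a :: p ++ b :: s) -> 1 < deg e (last a p).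
Proof.
rewrite -cat_cons nbwalk_cat => /andP[wp /and3P[xb bz _]].
case/and3P: wp => ra ar wp; have zx := nbwalk_pred ra wp.
by apply: (@deg_gt1 _ (last r (belast a p)) b); rewrite // 1?esym // eq_sym.
Qed.

(** Leaves other than [r] are counted by the first step of the walk to them from [r]: of two walks
    in one leg the shorter is a prefix of the longer, and a proper prefix ends at a vertex of degree
    at least two. *)
Lemma leaves_of_center : #|leaves e| <= 3.
Proof.
have [w wP wl] := fin_all_exists2 (tree_walk r).
suff le_r : #|leaves e :\ r| <= deg e r.
  (* If [r] is itself a leaf, at most one other leaf remains. *)
  rewrite (cardsD1 r) inE -/(deg e r); case: eqP => [d1|_]; last exact: leq_trans (proj1 rP).
  by rewrite d1 in le_r; rewrite (leq_trans (leq_add (leqnn 1) le_r)).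
have wcons x : x != r -> exists a p, w x = a :: p.
  by case: (w x) (wl x) => [/= ->|a p _ _]; [rewrite eqxx|exists a, p].
rewrite -(card_in_imset (f := fun x => head r (w x))); last first.
  move=> x y; rewrite !inE => /andP[xr dx] /andP[yr dy].
  have [[a [p wx]] [b [q wy]]] := (wcons x xr, wcons y yr).
  rewrite wx wy /= => ab; subst b.
  wlog pq : x y p q wx wy xr yr dx dy / size p <= size q => [wl'|].
    have [pq|/ltnW pq] := leqP (size p) (size q); first exact: (wl' x y p q).
    by symmetry; apply: (wl' y x q p).
  have [wp wq] := (wP x, wP y); rewrite wx wy in wp wq.
  have [[|b s] def_q] := same_leg wp wq pq.
    by rewrite -(wl x) -(wl y) wx wy def_q cats0.
  rewrite def_q in wq; have := inner_deg wq.
  by rewrite (_ : last a p = x) ?/deg ?(eqP dx) // -(wl x) wx.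
apply: subset_leq_card; apply/subsetP=> _ /imsetP[x + ->].
rewrite !inE => /andP[xr _]; have [a [p wx]] := wcons x xr.
by have := wP x; rewrite wx => /and3P[].
Qed.

(** [depth] is the length of the walk from [r], and [leg] the rank of its first vertex among the
    neighbours of [r], with default 0 at [r] itself; hence the exceptions for depth 0. *)
Lemma tree_coordinates : exists leg depth : T -> nat,
  [/\ forall x, leg x < 3, forall x, depth x < #|T|,
     forall x y, depth x = depth y -> depth x = 0 \/ leg x = leg y -> x = y
   & forall x y, e x y ->
       (depth y = (depth x).+1 /\ (depth x = 0 \/ leg x = leg y)) \/
       (depth x = (depth y).+1 /\ (depth y = 0 \/ leg y = leg x))].
Proof.
have [w wP wl] := fin_all_exists2 (tree_walk r).
pose leg x := if w x is a :: _ then index a (enum [set y | e r y]) else 0.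
have grow x y : e x y -> w y = rcons (w x) y \/ w x = rcons (w y) x.
  move=> xy; have xy' : e (last r (w x)) y by rewrite wl.
  case: (nbwalk_extend (wP x) xy') => [wxy|[q wx lq]|[wx yr]].
  - by left; apply: tree_nbwalk_inj (wP y) wxy _; rewrite wl last_rcons.
  - right; rewrite {1}wx wl; congr rcons; apply: tree_nbwalk_inj (wP y) _; last by rewrite lq.
    by have := wP x; rewrite wx -cats1 nbwalk_cat => /andP[].
  - by have := wl x; rewrite wx /= => rx; rewrite -rx yr eirr in xy.
have legP x y : w y = rcons (w x) y ->
    size (w y) = (size (w x)).+1 /\ (size (w x) = 0 \/ leg x = leg y).
  rewrite /leg => ->; rewrite size_rcons; split=> //.
  by case: (w x) => [|a p]; [left|right].
exists leg, (fun x => size (w x)); split.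
- move=> x; rewrite /leg; case: (w x) (wP x) => [|a p /and3P[ra _ _]] //.
  by apply: leq_trans (proj1 rP); rewrite /deg cardE index_mem mem_enum inE.
- move=> x; have /card_uniqP := tree_nbwalk_uniq (wP x).
  by have := max_card (mem (r :: w x)) => /[swap]->.
- move=> x y sxy lxy; rewrite -(wl x) -(wl y); congr (last r).
  move: (wP x) (wP y) sxy lxy; rewrite /leg.
  case: (w x) (w y) => [|a p] [|b q] // wp wq [sz] [//|] ab.
  have ab' : a = b.
    have [ra rb] : e r a /\ e r b by case/and3P: wp => ->; case/and3P: wq => ->.
    have ax : a \in enum [set y | e r y] by rewrite mem_enum inE.
    have bx : b \in enum [set y | e r y] by rewrite mem_enum inE.
    by rewrite -(nth_index r ax) ab nth_index.
  subst b; have [|[|c s] def_q] := same_leg wp wq; first by rewrite sz.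
    by rewrite def_q cats0.
  by move: sz; rewrite def_q size_cat /=; lia.
- by move=> x y /grow[/legP|/legP]; [left|right].
Qed.

End Center.

End Trees.

Lemma comp_connected (T : finType) (e : rel T) (x0 : T) : symmetric e ->
  forall x y : comp_type e x0, connect (comp_rel e x0) x y.
Proof.
move=> es x y; have : connect e (val x) (val y).
  by apply: connect_trans (valP y); rewrite (sym_connect_sym es); apply: (valP x).
case/connectP=> p; elim: p x => [|z p IH] x /=; first by move=> _ /val_inj->.
case/andP=> xz pz yE; have cz : connect e x0 z := connect_trans (valP x) (connect1 xz).
apply: (@connect_trans _ _ (Sub z cz)); last exact: IH.
exact: connect1.
Qed.

Lemma cycle_nbwalk (T : finType) (e : rel T) (x : T) c : uniq (x :: c) -> 1 < size c ->
  cycle e (x :: c) -> nbwalk e x x (rcons c x).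
Proof.
move=> xc c2; rewrite [cycle _ _]/= rcons_path => /andP[pc cx].
rewrite -cats1 nbwalk_cat uniq_nbwalk_refl //= cx andbT.
case: c c2 xc {pc cx} => [|a [|b c]] // _ /andP[xN _].
apply: contraNneq xN => ->; exact/mem_belast/(mem_last a (belast b c)).
Qed.

Lemma deg_hom (T U : finType) (e : rel T) (f : rel U) (h : T -> U) x : injective h ->
  (forall x y, e x y -> f (h x) (h y)) -> deg e x <= deg f (h x).
Proof.
move=> hinj hom; rewrite /deg -(card_imset _ hinj); apply: subset_leq_card.
by apply/subsetP=> _ /imsetP[y + ->]; rewrite !inE => /hom.
Qed.

(** The graph of [evasive_subcubic] for [C] has too large a cop number to be [H]-subgraph-free. With
    [M] the order of [H], the embedded copy forbids cycles and pairs of branch vertices in a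
    component. *)
Lemma bounded_components (TH : finType) (eH : rel TH) : simple_graph eH ->
  bounded_cop_number_Hfree eH ->
  forall v : TH, is_tree (comp_rel eH v) /\ #|leaves (comp_rel eH v)| <= 3.
Proof.
case=> Hs Hi [C bound] v.
have [T [e [[es ei] girth d3 far evade]]] := evasive_subcubic C #|TH|.
have [[f0 [f0inj f0hom]]|free] := classic (has_subgraph eH e); last first.
  by case: evade; apply: bound.
pose K := comp_type eH v; pose eK := comp_rel eH v.
pose f (x : K) := f0 (val x).
have finj : injective f by move=> x y /f0inj/val_inj.
have fhom x y : eK x y -> e (f x) (f y) by apply: f0hom.
have Ks : symmetric eK by apply: comp_rel_sym.
have Ki : irreflexive eK by apply: comp_rel_irr.
have KTH : #|K| <= #|TH| by rewrite card_sub max_card.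
have ac : acyclic eK.
  move=> [|x c] // uc c3; apply/negP=> /(cycle_nbwalk uc c3).
  move/(nbwalk_map finj fhom) => wc; apply: (girth _ _ _ wc); last by rewrite last_map last_rcons.
  rewrite size_map size_rcons /= (leq_trans _ KTH) //.
  by have := max_card (mem (x :: c)); rewrite (card_uniqP uc).
have Kc : forall x y, connect eK x y by apply: comp_connected.
have Kg N : nb_girth_gt eK N by apply: acyclic_nb_girth.
split=> //; have cv : connect eH v v by apply: connect0.
have [||r rP] := @center_exists _ eK (Sub v cv).
- by move=> x; apply: leq_trans (d3 (f x)); apply: deg_hom.
- move=> x y xy dx; have [p wp lp] := tree_walk Kc x y.
  have /card_uniqP := tree_nbwalk_uniq Ki Kg wp => sp.
  rewrite -lp; apply: leq_trans (deg_hom _ finj fhom) _; rewrite -(last_map f).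
  apply: far; last exact: nbwalk_map wp.
    exact: leq_trans dx (deg_hom _ finj fhom).
  have pK : size p < #|K| by have := max_card (mem (x :: p)); rewrite sp.
  rewrite size_map (ltnW (leq_trans pK KTH)) andbT.
  by case: p lp {wp sp pK} => //= xy'; rewrite xy' eqxx in xy.
exact: leaves_of_center rP.
Qed.

(** * Catching the robber *)

Section Territory.

Variables (T : finType) (e : rel T).
Hypothesis esym : symmetric e.
Implicit Types (S : {set T}) (r x y : T).

Definition avoid S : rel T := fun x y => [&& e x y, x \notin S & y \notin S].

Definition territory S r := [set x | connect (avoid S) r x].

Lemma avoid_sym S : connect_sym (avoid S).
Proof. by apply: sym_connect_sym => x y; rewrite /avoid esym [(x \notin S) && _]andbC. Qed.

Lemma territory_refl S r : r \in territory S r.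
Proof. by rewrite inE connect0. Qed.

Lemma territory_trans S r x y : x \in territory S r -> y \in territory S x ->
  y \in territory S r.
Proof. by rewrite !inE; apply: connect_trans. Qed.

Lemma territory_step S r x : r \notin S -> x \notin S -> e r x -> x \in territory S r.
Proof. by move=> rS xS rx; rewrite inE connect1 // /avoid rx rS. Qed.

Lemma territory_closed S r (A : {set T}) : r \in A ->
  (forall x y, x \in A -> avoid S x y -> y \in A) -> territory S r \subset A.
Proof.
move=> rA clA; apply/subsetP=> x; rewrite inE => /connectP[p].
elim: p r rA => [|y p IH] r rA /=; first by move=> _ ->.
by case/andP=> ry; apply: IH; apply: clA ry.
Qed.

Lemma territory_avoid S r : r \notin S -> territory S r \subset ~: S.
Proof.
by move=> rS; apply: territory_closed => [|x y _ /and3P[_ _]]; rewrite inE.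
Qed.

Lemma territory_sub S S' r x : S \subset S' -> x \in territory S r ->
  territory S' x \subset territory S r.
Proof.
move=> sS xr; apply: territory_closed => // y z yr /and3P[yz yS zS].
apply: territory_trans yr (territory_step _ _ yz).
  exact: contra (subsetP sS y) yS.
exact: contra (subsetP sS z) zS.
Qed.

(** Cut a walk from [r] at its first visit to [x]; the vertex before it stays reachable after [x] is
    blocked. *)
Lemma territory_last S r x : x \in territory S r -> x != r ->
  exists2 y, y \in territory (x |: S) r & e y x.
Proof.
rewrite inE => /connectP[p]; case/lastP: p => [_ ->|p z]; first by rewrite eqxx.
rewrite last_rcons => pz zx; subst z; have [q] := ubnP (size p).
elim: q r p pz => // q IH r p pz sp xr.
case: p pz sp => [|y p] /=.
  by case/andP=> /and3P[rx _ _] _ _; exists r; rewrite ?territory_refl.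
case/andP=> /and3P[ry rS yS] pz sp; have [xy|xy] := eqVneq x y.
  by subst y; exists r; rewrite ?territory_refl.
have [z zy zx] := IH y p pz sp xy; exists z => //.
apply: territory_trans zy; apply: territory_step => //; rewrite !inE negb_or.
  by rewrite eq_sym xr.
by rewrite eq_sym xy.
Qed.

End Territory.

Section Cops.

Variables (T : finType) (e : rel T) (k : nat).
Hypothesis esym : symmetric e.
Hypothesis econn : forall x y, connect e x y.
Implicit Types (c : {ffun 'I_k -> T}) (S X A : {set T}) (r : T).

Definition occupied c S := forall x, x \in S -> exists i, c i = x.

(** Otherwise every cop would be alone on a vertex of [S], and [c] would inject the cops into
    [S]. *)
Lemma spare_cop c S : occupied c S -> #|S| < k ->
  exists i0, forall x, x \in S -> exists2 i, i != i0 & c i = x.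
Proof.
move=> occ Sk; have [i0 spare|used] := pickP (fun i0 =>
    [forall x in S, exists i, (i != i0) && (c i == x)]).
  exists i0 => x xS; have /existsP[i /andP[ii0 /eqP ci]] := forall_inP spare x xS.
  by exists i.
have needed i0 : c i0 \in S /\ forall i, c i = c i0 -> i = i0.
  have /negbT := used i0; rewrite negb_forall_in => /exists_inP[x xS /existsPn only].
  have only' i : c i = x -> i = i0.
    by move=> ci; apply/eqP; have := only i; rewrite ci eqxx andbT negbK.
  by have [i ci] := occ x xS; rewrite -(only' i ci) ci; split=> // j /only'->; rewrite (only' i).
have: #|c @: [set: 'I_k]| <= #|S|.
  by apply: subset_leq_card; apply/subsetP=> _ /imsetP[i _ ->]; case: (needed i).
rewrite card_in_imset ?cardsT ?card_ord; first by rewrite leqNgt Sk.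
by move=> i j _ _ /(proj2 (needed j)).
Qed.

(** A spare cop walks to [x] while the others hold [S] and so confine the robber to its territory;
    the last premise takes over from wherever the robber is by then. *)
Lemma place_cop x c S r : occupied c S -> #|S| < k -> r \notin S ->
  (forall c' r', occupied c' (x |: S) -> r' \in territory e S r -> r' \notin x |: S ->
     cwin e c' r') -> cwin e c r.
Proof.
move=> occ Sk; have [i0] := spare_cop occ Sk; clear occ.
have /connectP[p] := econn (c i0) x.
elim: p c r => [|y p IH] c r /= pp xE spare rS win.
  have [rx|rx] := eqVneq r x.
    by apply: (CWin (c' := c)); [left|left; exists i0; rewrite rx].
  apply: win; rewrite ?territory_refl ?inE ?negb_or ?rx //.
  by move=> z; rewrite !inE => /orP[/eqP->|/spare[i _ <-]]; [exists i0|exists i].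
case/andP: pp => cy pp; pose c' := [ffun i => if i == i0 then y else c i].
have spare' z : z \in S -> exists2 i, i != i0 & c' i = z.
  by case/spare=> i ii0 <-; exists i; rewrite // ffunE (negPf ii0).
apply: (CWin (c' := c')).
  by move=> i; rewrite ffunE; case: eqP => [->|_]; [right|left].
right=> r' mv; have [/existsP[i /eqP ci]|/existsPn free] := boolP [exists i, c' i == r'].
  by left; exists i.
have r'S : r' \notin S by apply/negP=> /spare'[i _ ci]; case/eqP: (free i).
have r't : r' \in territory e S r.
  by case: mv => [->|rr']; [exact: territory_refl|exact: territory_step].
right; apply: (IH c' r') => //; first by rewrite ffunE eqxx.
  by rewrite ffunE eqxx.
by move=> c'' r'' occ'' /(territory_trans r't); apply: win.
Qed.

Lemma place_cops s c S r : occupied c S -> #|S| + size s <= k -> r \notin S ->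
  (forall c' r', occupied c' (S :|: [set:: s]) -> r' \in territory e S r ->
     r' \notin S :|: [set:: s] -> cwin e c' r') -> cwin e c r.
Proof.
elim: s c S r => [|x s IH] c S r occ sk rS win.
  have S0 : S :|: [set:: [::]] = S by apply/setP=> x; rewrite !inE orbF.
  by apply: win; rewrite ?S0 ?territory_refl.
have SxS : x |: S :|: [set:: s] = S :|: [set:: x :: s].
  by apply/setP=> y; rewrite !inE orbCA !orbA.
apply: (@place_cop x c S r occ _ rS) => [|c' r' occ' r't r'S]; first by move: sk => /=; lia.
apply: (IH c' (x |: S) r' occ') => //.
  by move: sk => /=; rewrite cardsU1; lia.
rewrite SxS => c'' r'' occ'' r''t; apply: win => //.
by apply: subsetP r''t; apply: territory_sub r't; apply: subsetUr.
Qed.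

Variable m : nat.

Definition spider A y l1 l2 l3 :=
  [/\ [/\ size l1 = m, size l2 = m & size l3 = m],
      [/\ path e y l1, path e y l2 & path e y l3],
      uniq (y :: l1 ++ l2 ++ l3) & {subset y :: l1 ++ l2 ++ l3 <= A}].

(** Choosing each spider in what the previous ones leave of [A] fits the induction in [catch], where
    occupying a spider removes it from the territory. *)
Fixpoint disjoint_spiders p A :=
  if p is p'.+1 then exists y l1 l2 l3, spider A y l1 l2 l3 /\
    disjoint_spiders p' (A :\: [set:: y :: l1 ++ l2 ++ l3])
  else True.

Lemma disjoint_spiders_sub p A A' : A \subset A' ->
  disjoint_spiders p A -> disjoint_spiders p A'.
Proof.
elim: p A A' => //= p IH A A' sA [y [l1 [l2 [l3 [[sl pl ul lA] dis]]]]].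
exists y, l1, l2, l3; split.
  by split=> // z /lA; apply: (subsetP sA).
by apply: IH dis; apply: setSD.
Qed.

(* The only vertices of the path [s], listed from its tip, that the cops keep
   occupying. *)
Definition guarded (s : seq T) := take (2 * m) s ++ drop (size s - m) s.

(** When the path grows at its tip, only the new vertex comes under guard, so placing one cop is
    enough. *)
Lemma guarded_cons x s : {subset guarded (x :: s) <= x :: guarded s}.
Proof.
move=> y; rewrite /guarded inE !mem_cat => /orP[].
  case: (2 * m) => [|n]; rewrite ?take0 //= inE => /orP[->//|yn].
  rewrite (_ : y \in take n.+1 s) ?orbT //.
  by rewrite -(cat_take_drop n (take n.+1 s)) take_takel // mem_cat yn.
case: (leqP m (size s)) => ms; first by rewrite /= subSn //= => ->; rewrite !orbT.
rewrite (_ : size (x :: s) - m = 0) ?drop0 ?inE; last by move=> /=; lia.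
by rewrite (_ : size s - m = 0) ?drop0; [case/orP=> ->; rewrite ?orbT|lia].
Qed.

Lemma size_guarded s : size (guarded s) <= 3 * m.
Proof. by rewrite size_cat size_drop size_take; case: ifP; lia. Qed.

Lemma guardedP s1 y s2 : y \notin guarded (s1 ++ y :: s2) ->
  m <= size s1 - m /\ m <= size s2.
Proof.
rewrite mem_cat negb_or => /andP[yt yd].
suff: 2 * m <= size s1 /\ m <= size s2 by case; split; lia.
split; rewrite leqNgt.
  apply: contra yt => lt; rewrite take_cat ltnNge (ltnW lt) /=.
  by case E: (_ - _) => [|n]; [lia|rewrite mem_cat /= inE eqxx orbT].
apply: contra yd => lt; rewrite drop_cat size_cat /=.
case: ifP => [_|]; first by rewrite mem_cat inE eqxx orbT.
by move=> nlt; rewrite (_ : _ - _ - _ = 0) ?inE ?eqxx //; lia.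
Qed.

(** The legs from [y] run down [s2], up [rev s1], and via [z] through the territory to [x] and from
    there down [s1]. *)
Lemma spider_of_back_edge S r s x y z A :
    [set:: s] \subset S -> r \notin S ->
    x \in territory e S r -> path e x s -> uniq s ->
    territory e S r \subset A -> {subset s <= A} ->
    y \in s -> y \notin guarded s -> z \in territory e S r -> e y z ->
  exists l1 l2 l3, spider A y l1 l2 l3.
Proof.
move=> sS rS xC ps us CA sA ys; case/splitPr: ys ps us sA sS => s1 s2 ps us sA sS yg zC yz.
have [ms1 ms2] := guardedP yg.
have CS w : w \in territory e S r -> w \notin s1 ++ y :: s2.
  move=> wC; apply: contraL (subsetP (territory_avoid e rS) w wC) => ws.
  by rewrite inE negbK (subsetP sS) // inE.
have : connect (avoid e S) z x.
  move: xC zC; rewrite !inE => rx rz; apply: connect_trans rx.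
  by rewrite (avoid_sym esym).
case/connectP=> q pq xE; case/shortenP: pq xE => {}q pq uq _ xE.
have qC w : w \in z :: q -> w \in territory e S r.
  move=> wq; apply: territory_trans zC _; rewrite inE.
  by apply: (path_connect pq).
have peq : path e z q by apply: sub_path pq => a b /and3P[].
(* The second leg takes up [b], the [m] vertices next to [y]; the part [a] at the tip has at least
   [m] more, so the third leg ends before reaching [b]. *)
set n := size s1 - m.
pose a := take n s1; pose b := drop n s1.
have s1E : s1 = a ++ b by rewrite cat_take_drop.
move: ps; rewrite cat_path /= => /and3P[ps1 ps1y ps2].
have prs1 : path e y (rev s1).
  have := rev_path e x (rcons s1 y); rewrite last_rcons belast_rcons rev_cons.
  rewrite (eq_path (e' := e)) => [|u v]; last by rewrite esym.
  by rewrite !rcons_path ps1 ps1y => /andP[].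
exists (take m s2), (take m (rev s1)), (take m (z :: q ++ s1)); split.
- have ms1' : m <= size s1 := leq_trans ms1 (leq_subr _ _).
  by rewrite !size_takel ?size_rev //= size_cat (leq_trans ms1') // leqW // leq_addl.
- split; apply: take_path => //=.
  by rewrite yz cat_path peq -xE.
- have ma : m <= size a by rewrite size_takel ?leq_subr.
  have -> : take m (z :: q ++ s1) = take m (z :: q ++ a).
    by rewrite {1}s1E catA -cat_cons takel_cat //= size_cat leqW // (leq_trans ma) ?leq_addl.
  have -> : take m (rev s1) = rev b by rewrite take_rev.
  apply: (@subseq_uniq _ _ (y :: s2 ++ rev b ++ z :: q ++ a)).
    rewrite /= eqxx; apply: cat_subseq; first exact: take_subseq.
    by apply: cat_subseq => //; apply: take_subseq.
  rewrite (perm_uniq (s2 := (z :: q) ++ (s1 ++ y :: s2))); last first.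
    apply/permP=> f; rewrite s1E /= !count_cat /= !count_cat /= count_rev; clear; lia.
  rewrite cat_uniq uq us andbT; apply/hasPn=> w ws.
  by apply/negP=> /qC/CS; rewrite ws.
move=> w; rewrite inE !mem_cat => /or4P[/eqP->|/mem_take ws|/mem_take ws|/mem_take].
- by apply: sA; rewrite mem_cat inE eqxx orbT.
- by apply: sA; rewrite mem_cat inE ws !orbT.
- by apply: sA; rewrite mem_cat -mem_rev ws.
rewrite -cat_cons mem_cat => /orP[/qC|ws]; first exact: (subsetP CA).
by apply: sA; rewrite mem_cat ws.
Qed.

(** The territory is measured against all of [s], though only [guarded s] is occupied. The guards
    number at most [3 * m], and one more cop extends the path. *)
Lemma sweep X A n s r c :
  (forall y l1 l2 l3, ~ spider A y l1 l2 l3) -> #|X| + 3 * m < k ->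
  #|territory e (X :|: [set:: s]) r| < n -> r \notin X :|: [set:: s] ->
  territory e (X :|: [set:: s]) r \subset A -> {subset s <= A} -> uniq s ->
  (exists2 x, x \in territory e (X :|: [set:: s]) r & path e x s) ->
  occupied c (X :|: [set:: guarded s]) -> cwin e c r.
Proof.
move=> noS Xk; elim: n s r c => // n IH s r c.
set S := X :|: [set:: s]; set C := territory e S r.
move=> Cn rS CA sA us [x xC xs] occ.
set S' := X :|: [set:: guarded s] in occ.
have gs : {subset guarded s <= s}.
  by move=> y; rewrite mem_cat => /orP[/mem_take|/mem_drop].
have S'S : S' \subset S.
  by apply: setUS; apply/subsetP=> y; rewrite !inE; apply: gs.
(* Leaving [C] would mean an edge to an unguarded vertex of the path, which [spider_of_back_edge]
   turns into a spider. *)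
have S'C : territory e S' r \subset C.
  apply: territory_closed => [|z y zC /and3P[zy _ yS']]; first exact: territory_refl.
  apply: (territory_trans zC); apply: territory_step => //.
    by have := subsetP (territory_avoid e rS) z zC; rewrite inE.
  apply/negP=> yS; have ys : y \in s.
    by move: yS' yS; rewrite !inE negb_or => /andP[/negPf->].
  have yg : y \notin guarded s by move: yS'; rewrite !inE negb_or => /andP[].
  rewrite esym in zy.
  have sS : [set:: s] \subset S by apply: subsetUr.
  have [l1 [l2 [l3 sp]]] := spider_of_back_edge sS rS xC xs us CA sA ys yg zC zy.
  exact: noS sp.
have cS' : #|S'| < k.
  apply: leq_ltn_trans Xk; apply: leq_trans (leq_card_setU _ _) _.
  rewrite leq_add2l (leq_trans _ (size_guarded s)) //.
  by rewrite cardsE card_size.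
apply: (@place_cop x c S' r occ cS').
  exact: contra (subsetP S'S r) rS.
move=> c' r' occ' /(subsetP S'C) r'C; rewrite inE negb_or inE => /andP[r'x r'S'].
have r'S : r' \notin S.
  by have := subsetP (territory_avoid e rS) r' r'C; rewrite inE.
have xS : x \notin S.
  by have := subsetP (territory_avoid e rS) x xC; rewrite inE.
have SE : X :|: [set:: x :: s] = x |: S by apply/setP=> y; rewrite !inE orbCA.
have r'xS : r' \notin x |: S by rewrite inE negb_or inE r'x.
have subC : territory e (x |: S) r' \subset C.
  by apply: territory_sub r'C; apply: subsetUr.
apply: (IH (x :: s)); rewrite ?SE //.
(* The territory shrinks strictly because it loses [x]. *)
- rewrite -ltnS; apply: leq_trans Cn; rewrite ltnS; apply: proper_card.
  rewrite properE subC; apply/subsetPn; exists x => //.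
  apply/negP=> /(subsetP (territory_avoid e r'xS)).
  by rewrite !inE eqxx.
- exact: subset_trans subC CA.
- by move=> y; rewrite inE => /orP[/eqP->|/sA //]; apply: (subsetP CA).
- by rewrite /= us andbT; move: xS; rewrite !inE negb_or => /andP[].
- have xr' : x \in territory e S r'.
    by move: xC r'C; rewrite !inE => rx rr'; apply: connect_trans rx; rewrite (avoid_sym esym).
  have [|z zt zx] := territory_last xr'; first by rewrite eq_sym.
  by exists z; rewrite //= zx xs.
move=> y yg; apply: occ'; move: yg; rewrite !inE => /orP[->|/guarded_cons]; rewrite ?orbT //.
by rewrite inE => /orP[->|->]; rewrite ?orbT.
Qed.

(** Each spider found in the territory is occupied by [3 * m + 1] cops, which lowers [p]; one
    further share of that size pays for [sweep] when no spider is left. *)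
Lemma catch p X r c : ~ disjoint_spiders p (territory e X r) ->
  #|X| + p.+1 * (3 * m).+1 <= k -> occupied c X -> r \notin X -> cwin e c r.
Proof.
elim: p X r c => [|p IH] X r c nosp Xk occ rX; first by case: nosp.
have [[y [l1 [l2 [l3 sp]]]]|none] :=
  classic (exists y l1 l2 l3, spider (territory e X r) y l1 l2 l3); last first.
  have X0 : X :|: [set:: [::]] = X by apply/setP=> x; rewrite !inE orbF.
  apply: (@sweep X (territory e X r) _ [::] r c) => //; rewrite ?X0 //.
  - by move=> y l1 l2 l3 sp; apply: none; exists y, l1, l2, l3.
  - by lia.
  - by exists r; rewrite ?territory_refl.
set L := y :: l1 ++ l2 ++ l3.
have sL : size L = (3 * m).+1.
  by case: sp => -[s1 s2 s3] _ _ _; rewrite /= !size_cat s1 s2 s3; lia.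
apply: (@place_cops L c X r occ) => [|//|c' r' occ' r't r'X].
  by rewrite sL; lia.
apply: (IH _ _ _ _ _ occ' r'X).
  move=> dis; apply: nosp; exists y, l1, l2, l3; split=> //.
  apply: disjoint_spiders_sub dis; rewrite subsetD (territory_sub _ r't) ?subsetUl //=.
  rewrite disjoints_subset (subset_trans (territory_avoid e r'X)) // setCS subsetUr //.
have := (leq_card_setU X [set:: L]).1; have : #|[set:: L]| <= size L by rewrite cardsE card_size.
by rewrite sL; lia.
Qed.

End Cops.

(** * Embedding forests of spiders *)

Section SpiderCoordinates.

Variables (T : finType) (e : rel T) (m : nat).

Lemma spider_coordinates A y l1 l2 l3 : spider e m A y l1 l2 l3 ->
  exists g : nat -> nat -> T,
  [/\ forall l d, l < 3 -> d <= m -> g l d \in y :: l1 ++ l2 ++ l3,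
      forall l, g l 0 = g 0 0,
      forall l d, l < 3 -> d < m -> e (g l d) (g l d.+1)
    & forall l d l' d', l < 3 -> l' < 3 -> d <= m -> d' <= m -> g l d = g l' d' ->
        d = d' /\ (d = 0 \/ l = l')].
Proof.
case=> -[s1 s2 s3] [p1 p2 p3] uW _; set W := y :: l1 ++ l2 ++ l3 in uW *.
have sW : size W = (3 * m).+1 by rewrite /= !size_cat s1 s2 s3; lia.
(* The position in [W] of the vertex at depth [d] on leg [l]; all legs share the centre at position
   0. *)
pose idx l d := if d is 0 then 0 else l * m + d.
have idx_lt l d : l < 3 -> d <= m -> idx l d < size W.
  by rewrite sW; case: l => [|[|[|//]]] _; case: d => [|d] //= dm; lia.
pose leg l := nth [::] [:: l1; l2; l3] l.
have legE l d : l < 3 -> d <= m -> nth y W (idx l d) = nth y (y :: leg l) d.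
  case: d => [|d] // l3' dm; have -> : idx l d.+1 = (l * m + d).+1 by rewrite -addnS.
  rewrite /= !nth_cat s1 s2 /leg; case: l l3' => [|[|[|//]]] _ /=.
  - by rewrite mul0n add0n dm.
  - by rewrite mul1n addKn dm ltnNge leq_addr.
  - by rewrite mul2n -addnn -addnA addKn ltnNge leq_addr /= addKn ltnNge leq_addr.
have pleg l : l < 3 -> path e y (leg l) /\ size (leg l) = m by case: l => [|[|[|]]].
exists (fun l d => nth y W (idx l d)); split=> //.
- by move=> l d l3' dm; rewrite mem_nth ?idx_lt.
- move=> l d l3' dm; rewrite !legE // ?(ltnW dm) //.
  by have [/(pathP y) pl sl] := pleg l l3'; apply: pl; rewrite sl.
move=> l d l' d' l3' l3'' dm dm' /eqP; rewrite nth_uniq ?idx_lt // => /eqP.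
case: d d' dm dm' => [|d] [|d'] //=; [by split; auto|lia|lia|].
by case: l l3' => [|[|[|//]]] _; case: l' l3'' => [|[|[|//]]] _ dm dm' E; split; auto; lia.
Qed.

Lemma disjoint_spiders_coordinates (x0 : T) p A : disjoint_spiders e m p A ->
  exists F : nat -> nat -> nat -> T,
  [/\ forall i l d, i < p -> l < 3 -> d <= m -> F i l d \in A,
      forall i l, i < p -> F i l 0 = F i 0 0,
      forall i l d, i < p -> l < 3 -> d < m -> e (F i l d) (F i l d.+1)
    & forall i l d i' l' d', i < p -> i' < p -> l < 3 -> l' < 3 -> d <= m -> d' <= m ->
        F i l d = F i' l' d' -> [/\ i = i', d = d' & d = 0 \/ l = l']].
Proof.
elim: p A => [|p IH] A /=.
  by exists (fun _ _ _ => x0).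
case=> y [l1 [l2 [l3 [sp /IH[F [FA F0 Fe Finj]]]]]].
have WA : {subset y :: l1 ++ l2 ++ l3 <= A} by case: sp.
have [g [gW g0 ge ginj]] := spider_coordinates sp.
have disj i l d l' d' : i < p -> l < 3 -> d <= m -> l' < 3 -> d' <= m ->
    g l' d' <> F i l d.
  move=> ip l3' dm l3'' dm' E; have := FA i l d ip l3' dm.
  by rewrite in_setD inE -E gW.
exists (fun i => if i is j.+1 then F j else g); split.
- case=> [|i] l d ip l3' dm; first exact/WA/gW.
  by have := FA i l d ip l3' dm; rewrite in_setD => /andP[].
- by case=> [|i] l ip; [apply: g0|apply: F0].
- by case=> [|i] l d ip; [apply: ge|apply: Fe].
case=> [|i] l d [|i'] l' d' //= ip ip' l3' l3'' dm dm' E.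
- by have [] := ginj _ _ _ _ l3' l3'' dm dm' E.
- by case: (disj i' l' d' l d).
- by case: (disj i l d l' d').
- by have [] := Finj _ _ _ _ _ _ ip ip' l3' l3'' dm dm' E => // ->.
Qed.

End SpiderCoordinates.

(* The value of [leg] at the centre, the vertex of depth 0, is irrelevant. *)
Definition coordinates (T : finType) (e : rel T) (v : T) (leg depth : T -> nat) : Prop :=
  [/\ forall x, leg x < 3, forall x, depth x < #|T|,
      forall x y, connect e v x -> connect e v y -> depth x = depth y ->
        depth x = 0 \/ leg x = leg y -> x = y
    & forall x y, connect e v x -> connect e v y -> e x y ->
       (depth y = (depth x).+1 /\ (depth x = 0 \/ leg x = leg y)) \/
       (depth x = (depth y).+1 /\ (depth y = 0 \/ leg y = leg x))].

Lemma component_coordinates (T : finType) (e : rel T) (v : T) :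
    simple_graph e -> is_tree (comp_rel e v) -> #|leaves (comp_rel e v)| <= 3 ->
  exists leg depth, coordinates e v leg depth.
Proof.
move=> [es ei] [Kc ac] l3.
have Ks : symmetric (comp_rel e v) by apply: comp_rel_sym.
have Ki : irreflexive (comp_rel e v) by apply: comp_rel_irr.
have Kg N : nb_girth_gt (comp_rel e v) N by apply: acyclic_nb_girth.
have cv : connect e v v by apply: connect0.
have [r rP] := center_of_leaves Ks Ki Kc Kg (Sub v cv) l3.
have [leg [depth [leg3 depthK inj adj]]] := tree_coordinates Ks Ki Kc Kg rP.
have T0 : 0 < #|T| by apply/card_gt0P; exists v.
(* Outside the component both coordinates default to 0, which respects the two bounds; the other
   conditions concern the component only. *)
exists (fun x => oapp leg 0 (insub x)), (fun x => oapp depth 0 (insub x)); split.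
- by move=> x; case: insub => [u|] /=.
- move=> x; case: insub => [u|] //=.
  by apply: leq_trans (depthK u) _; rewrite card_sub max_card.
- by move=> x y cx cy; rewrite !insubT /= => dxy lxy; have /(congr1 val) := inj _ _ dxy lxy.
- by move=> x y cx cy xy; rewrite !insubT /=; apply: adj.
Qed.

(** Each component goes to the spider numbered by the rank of its root. There are at most [#|TH|]
    components and depths stay below [#|TH|], so that many spiders with legs of that length
    suffice. *)
Lemma embed_in_spiders (TH T : finType) (eH : rel TH) (e : rel T) (x0 : T) A :
    simple_graph eH -> symmetric e ->
    (forall v : TH, is_tree (comp_rel eH v) /\ #|leaves (comp_rel eH v)| <= 3) ->
  disjoint_spiders e #|TH| #|TH| A -> has_subgraph eH e.
Proof.
move=> sH es trees /(disjoint_spiders_coordinates x0)[F [_ F0 Fe Finj]].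
have Hs : connect_sym eH by apply: sym_connect_sym; case: sH.
have all_coordinates v : exists ld : (TH -> nat) * (TH -> nat), coordinates eH v ld.1 ld.2.
  have [tv lv] := trees v.
  by have [leg [depth P]] := component_coordinates sH tv lv; exists (leg, depth).
have [ld ldP] := fin_all_exists all_coordinates.
pose rt := root eH; have rt_conn x : connect eH (rt x) x by rewrite Hs connect_root.
pose f x := F (enum_rank (rt x)) ((ld (rt x)).1 x) ((ld (rt x)).2 x).
have rk x : enum_rank (rt x) < #|TH| by [].
exists f; split=> [x y|x y xy].
  have [lx dx _ _] := ldP (rt x); have [ly dy _ _] := ldP (rt y).
  case/Finj=> // [||/val_inj/enum_rank_inj rxy dxy lxy]; try exact: ltnW.
  have [_ _ inj _] := ldP (rt x); apply: inj => //; first by rewrite rxy.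
    by rewrite dxy rxy.
  by case: lxy => [|->]; [left|right; rewrite rxy].
have rxy : rt y = rt x by apply/eqP; rewrite eq_sym (root_connect Hs) connect1.
have [l3 dT _ adj] := ldP (rt x).
have up a b : rt a = rt x -> rt b = rt x ->
    (ld (rt x)).2 b = ((ld (rt x)).2 a).+1 ->
    (ld (rt x)).2 a = 0 \/ (ld (rt x)).1 a = (ld (rt x)).1 b -> e (f a) (f b).
  move=> ra rb db lab; rewrite /f ra rb db.
  have -> : F (enum_rank (rt x)) ((ld (rt x)).1 a) ((ld (rt x)).2 a) =
            F (enum_rank (rt x)) ((ld (rt x)).1 b) ((ld (rt x)).2 a).
    by case: lab => ->; rewrite ?F0 // [in RHS]F0.
  exact: Fe.
have cy : connect eH (rt x) y by rewrite -rxy.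
have [[dy lxy]|[dx lxy]] := adj x y (rt_conn x) cy xy; first exact: up.
by rewrite es; apply: up.
Qed.

Theorem theorem4 (TH : finType) (eH : rel TH) (HH : simple_graph eH) :
  bounded_cop_number_Hfree eH <->
  (forall v : TH, is_tree (comp_rel eH v) /\ #|leaves (comp_rel eH v)| <= 3).
Proof.
split=> [|trees]; first exact: bounded_components.
(* This is the budget of [catch] for [p = m = #|TH|] and no vertex occupied beforehand. *)
set k := #|TH|.+1 * (3 * #|TH|).+1.
exists k => T e [es ei] free v; exists k; split; first by rewrite leqnn muln_gt0.
pose v' : comp_type e v := Sub v (connect0 e v).
exists [ffun=> v'] => r; right.
have Ks : symmetric (comp_rel e v) by apply: comp_rel_sym.
apply: (@catch _ _ _ Ks (comp_connected es) #|TH| #|TH| set0).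
- move=> /(embed_in_spiders v' HH Ks trees)[f [finj fhom]].
  apply: free; exists (val \o f); split; first exact: inj_comp val_inj finj.
  by move=> x y /fhom.
- by rewrite cards0.
- by move=> x; rewrite inE.
- by rewrite inE.
Qed.
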